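(* Let $\mathcal{R}$ be a noetherian integral domain of characteristic zero such that the degree function $\deg : \mathcal{R}[Z]\setminus\{0\} \to \mathbb{Z}$ is diophantine. Then $\mathbb{Z}[Z]$ is a diophantine subset of $\mathcal{R}[Z]$.
   Context: $\mathcal{R}[Z]$ is the polynomial ring in one variable $Z$ over $\mathcal{R}$; since $\mathcal{R}$ has characteristic zero, $\mathbb{Z} \subseteq \mathcal{R}$ and $\mathbb{Z}[Z] \subseteq \mathcal{R}[Z]$. For an integral domain $A$, a subset $\mathcal{S} \subseteq A^k$ is called diophantine if there exists a polynomial $p(a_1,\dots,a_k,x_1,\dots,x_n)$ with coefficients in $A$ such that $\mathcal{S} = \{(a_1,\dots,a_k)\in A^k \mid p(a_1,\dots,a_k,x_1,\dots,x_n)=0 \text{ for some } x_1,\dots,x_n\in A\}$. Saying that the degree function is diophantine means that the composition $\mathcal{R}[Z]\setminus\{0\} \to \mathbb{Z} \hookrightarrow \mathcal{R}[Z]$ is diophantine, i.e. that the set $\{(F,\deg F) \mid F \in \mathcal{R}[Z]\setminus\{0\}\}$ is a diophantine subset of $\mathcal{R}[Z]^2$. *)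

(* Defs.v *)
From HB Require Import structures.
From mathcomp Require Import all_boot all_order all_algebra.
From mathcomp Require Import mpoly.

Set Implicit Arguments.
Unset Strict Implicit.
Unset Printing Implicit Defensive.

Import GRing.Theory.
Local Open Scope ring_scope.

Definition is_ideal (A : comNzRingType) (I : A -> Prop) : Prop :=
  [/\ I 0,
      forall x y : A, I x -> I y -> I (x + y)
    & forall a x : A, I x -> I (a * x)].

Definition finitely_generated (A : comNzRingType) (I : A -> Prop) : Prop :=
  exists (n : nat) (g : n.-tuple A), forall x : A,
    I x <-> exists c : n.-tuple A, x = \sum_(i < n) tnth c i * tnth g i.

Definition noetherian (A : comNzRingType) : Prop :=
  forall I : A -> Prop, is_ideal I -> finitely_generated I.

(* The k + n variables of p are the k parameters followed by the n unknowns. *)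
Definition diophantine (A : idomainType) (k : nat) (S : k.-tuple A -> Prop)
    : Prop :=
  exists (n : nat) (p : {mpoly A[k + n]}), forall a : k.-tuple A,
    S a <-> exists x : n.-tuple A, p.@[tnth [tuple of a ++ x]] = 0.

(* For F != 0, deg F = (size F).-1, embedded in R[Z] as a constant. *)
Definition degree_graph (R : idomainType) (t : 2.-tuple {poly R}) : Prop :=
  exists2 F : {poly R}, F != 0 & t = [tuple F; (size F).-1%:R].

(* The image of Z[Z] -> R[Z]; this map is injective when R has
   characteristic zero. *)
Definition int_polys (R : idomainType) (t : 1.-tuple {poly R}) : Prop :=
  exists q : {poly int}, t = [tuple map_poly (intr : int -> R) q].

(* Main.v *)
Require Import Defs.
From HB Require Import structures.
From mathcomp Require Import all_boot all_order all_algebra all_field.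
From mathcomp Require Import mpoly ring zify.
From Stdlib Require Import Classical_Prop.

Set Implicit Arguments.
Unset Strict Implicit.
Unset Printing Implicit Defensive.

Import GRing.Theory.
Local Open Scope ring_scope.

(** Write F' = 1 + Z F.  Every power series in 1 + Z Z[[Z]] is a product of
    integral powers of the series 1 - Z^d, so F in Z[Z] implies that F' is
    congruent to G1 / G2 modulo Z^D, where G1 and G2 divide a power of some
    Z^n - 1 and have constant term 1.  Conversely such a congruence with
    D > deg F' makes the coefficients of F' integers of the n-th cyclotomic
    field, all of whose conjugates are at most 2^(deg F' + deg G1 + deg G2) in
    absolute value.  If moreover F'(b) is a rational integer for a much larger
    power b of 2, the coefficients are the digits in a base b expansion of
    F'(b), and since a nonzero algebraic integer has a conjugate of absolute
    value at least 1, these digits are rational integers.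

    Powers are diophantine through the Pell equation X^2 - (A^2 - 1) Y^2 = 1
    over R[Z]: the degree of X determines the index of the solution (X, Y), and
    X + (P - A) Y is congruent to a power of P modulo P^2 - 2AP + 1.  The degree
    function also provides the natural numbers, as degrees. *)

(** * Diophantine predicates over environments *)

Section PolynomialFunctions.
Variable A : idomainType.
Implicit Types (f g : (nat -> A) -> A) (v w : nat -> A).

(** Variables are entries of an infinite environment, so that substitution and quantification only
    shift indices. [polyfun_ext] takes the place of functional extensionality. *)
Inductive polyfun : ((nat -> A) -> A) -> Prop :=
| polyfun_const c : polyfun (fun=> c)
| polyfun_var i : polyfun (fun v => v i)
| polyfun_add f g : polyfun f -> polyfun g -> polyfun (fun v => f v + g v)
| polyfun_mul f g : polyfun f -> polyfun g -> polyfun (fun v => f v * g v)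
| polyfun_ext f g : polyfun f -> f =1 g -> polyfun g.

Lemma polyfun_opp f : polyfun f -> polyfun (fun v => - f v).
Proof.
move=> pf; apply: polyfun_ext (polyfun_mul (polyfun_const (-1)) pf) _ => v.
exact: mulN1r.
Qed.

Lemma polyfun_exp f n : polyfun f -> polyfun (fun v => f v ^+ n).
Proof.
move=> pf; elim: n => [|n ihn]; first exact: (polyfun_const 1).
by apply: polyfun_ext (polyfun_mul pf ihn) _ => v; rewrite exprS.
Qed.

Lemma polyfun_muln f n : polyfun f -> polyfun (fun v => f v *+ n).
Proof.
move=> pf; apply: polyfun_ext (polyfun_mul pf (polyfun_const n%:R)) _ => v.
by rewrite mulr_natr.
Qed.

Lemma polyfun_sum (I : Type) (r : seq I) (F : I -> (nat -> A) -> A) :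
  (forall i, polyfun (F i)) -> polyfun (fun v => \sum_(i <- r) F i v).
Proof.
move=> pF; elim: r => [|i r ihr].
  by apply: polyfun_ext (polyfun_const 0) _ => v; rewrite big_nil.
by apply: polyfun_ext (polyfun_add (pF i) ihr) _ => v; rewrite big_cons.
Qed.

Lemma polyfun_prod (I : Type) (r : seq I) (F : I -> (nat -> A) -> A) :
  (forall i, polyfun (F i)) -> polyfun (fun v => \prod_(i <- r) F i v).
Proof.
move=> pF; elim: r => [|i r ihr].
  by apply: polyfun_ext (polyfun_const 1) _ => v; rewrite big_nil.
by apply: polyfun_ext (polyfun_mul (pF i) ihr) _ => v; rewrite big_cons.
Qed.

Lemma polyfun_meval n (p : {mpoly A[n]}) (F : 'I_n -> (nat -> A) -> A) :
  (forall i, polyfun (F i)) -> polyfun (fun v => p.@[fun i => F i v]).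
Proof.
move=> pF.
have h: polyfun (fun v => \sum_(m <- msupp p)
    (p@_m * \prod_(i <- index_enum 'I_n) F i v ^+ m i)).
  apply: polyfun_sum => m; apply: polyfun_mul (polyfun_const _) _.
  by apply: polyfun_prod => i; apply: polyfun_exp.
by apply: polyfun_ext h _ => v; rewrite mevalE.
Qed.

Lemma eq_polyfun f v w : polyfun f -> v =1 w -> f v = f w.
Proof.
move=> pf evw; elim: pf => //= [f1 g1 _ -> _ -> //|f1 g1 _ -> _ -> //|].
by move=> f1 g1 _ e1 e2; rewrite -!e2.
Qed.

Lemma polyfun_comp f (h : nat -> (nat -> A) -> A) : polyfun f ->
  (forall i, polyfun (h i)) -> polyfun (fun v => f (fun i => h i v)).
Proof.
move=> pf ph; elim: pf => {f} [c|i|f g _ pf _ pg|f g _ pf _ pg|f g _ pf e].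
- exact: polyfun_const.
- exact: ph.
- exact: polyfun_add.
- exact: polyfun_mul.
- by apply: polyfun_ext pf _ => v.
Qed.

(** Entries past the end of [t] read as the default 0, which matches the zero polynomial chosen for
    variables of index at least [m]. *)
Lemma polyfun_mpoly f m : polyfun f ->
  exists q : {mpoly A[m]}, forall t : m.-tuple A, f (nth 0 t) = q.@[tnth t].
Proof.
elim=> {f} [c|i|f g _ [p ep] _ [q eq]|f g _ [p ep] _ [q eq]|f g _ [p ep] e].
- by exists c%:MP => t; rewrite mevalC.
- have [lim|lmi] := ltnP i m.
    exists ('X_(Ordinal lim)) => t.
    by rewrite mevalXU (tnth_nth 0).
  by exists 0 => t; rewrite meval0 nth_default ?size_tuple.
- by exists (p + q) => t; rewrite mevalD ep eq.
- by exists (p * q) => t; rewrite mevalM ep eq.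
- by exists p => t; rewrite -e.
Qed.

(* The unknowns x are placed in front of the parameters v. *)
Definition scat (x : seq A) v i :=
  if (i < size x)%N then nth 0 x i else v (i - size x)%N.

Lemma scat_cat x y v : scat (x ++ y) v =1 scat x (scat y v).
Proof.
move=> i; rewrite /scat size_cat nth_cat.
case: (ltnP i (size x)) => [lix|lxi]; first by rewrite ltn_addr.
by rewrite ltn_subLR // subnDA.
Qed.
End PolynomialFunctions.

#[global] Hint Resolve polyfun_const polyfun_var polyfun_add polyfun_mul
  polyfun_opp polyfun_exp polyfun_muln : polyfun.

(** * Closure properties of diophantine predicates over R[Z] *)

Section DiophantineCalculus.
Variable R : idomainType.
Local Notation A := {poly R}.
Implicit Types (f g : (nat -> A) -> A) (S T : (nat -> A) -> Prop).
Implicit Types (v w : nat -> A).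

Definition dioph S := exists n f, polyfun f /\
  forall v, S v <-> exists2 x : seq A, size x = n & f (scat x v) = 0.

Lemma dioph_ext S T : dioph S -> (forall v, S v <-> T v) -> dioph T.
Proof.
move=> [n [f [pf ef]]] eST; exists n, f; split=> // v.
exact: iff_trans (iff_sym (eST v)) (ef v).
Qed.

Lemma dioph_eq f g : polyfun f -> polyfun g -> dioph (fun v => f v = g v).
Proof.
move=> pf pg; exists 0%N, (fun v => f v - g v); split=> [|v].
  by auto with polyfun.
split=> [e|[x /size0nil -> /eqP]].
  by exists [::] => //; rewrite (@eq_polyfun _ f _ v) ?(@eq_polyfun _ g _ v) //
    ?e ?subrr // => i; rewrite /scat /= subn0.
rewrite (@eq_polyfun _ f _ v) ?(@eq_polyfun _ g _ v) ?subr_eq0 // => [/eqP//||];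
  by move=> i; rewrite /scat /= subn0.
Qed.

(* In R[Z], p^2 and Z q^2 have degrees of different parity. *)
Lemma sqr_subX_eq0 (p q : A) : p ^+ 2 - 'X * q ^+ 2 = 0 <-> p = 0 /\ q = 0.
Proof.
split=> [/eqP|[-> ->]]; last by rewrite !expr0n mulr0 subr0.
rewrite subr_eq0 => /eqP e.
have [q0|qn0] := eqVneq q 0.
  by move: e; rewrite q0 expr0n mulr0 => /eqP; rewrite expf_eq0 => /eqP.
have pn0 : p != 0.
  by apply: contra_neq qn0 => p0; move/eqP: e; rewrite p0 expr0n eq_sym mulf_eq0
    polyX_eq0 expf_eq0 => /eqP.
move/(congr1 (fun r : A => size r)): e.
rewrite mulrC size_mulX ?expf_neq0 // !expr2 !size_mul // => e.
have := congr1 odd e.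
move: pn0 qn0; rewrite -!size_poly_gt0.
by case: (size p) (size q) => // a [] // b _ _ /=;
  rewrite !addnS /= !oddD !addbb.
Qed.

Lemma dioph_and S T : dioph S -> dioph T -> dioph (fun v => S v /\ T v).
Proof.
move=> [n [f [pf ef]]] [m [g [pg eg]]].
(* In [x ++ y] the first block serves [f] and the second [g]: to reach the parameters [f'] skips the
   m unknowns of [g], and [g'] skips the n unknowns of [f]. *)
pose f' w := f (fun i => if (i < n)%N then w i else w (i + m)%N).
pose g' w := g (fun i => w (i + n)%N).
exists (n + m)%N, (fun w => f' w ^+ 2 - 'X * g' w ^+ 2).
have pf' : polyfun f'.
  by apply: (@polyfun_comp _ _ (fun i w => if (i < n)%N then w i else w (i +
    m)%N))
    => // i; case: (i < n)%N; auto with polyfun.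
have pg' : polyfun g' by apply: polyfun_comp; auto with polyfun.
split=> [|v]; first by auto 10 with polyfun.
have sf x y : size x = n -> size y = m -> f' (scat (x ++ y) v) = f (scat x v).
  move=> sx sy; apply: (eq_polyfun pf) => i; rewrite !scat_cat /scat sx.
  case: (ltnP i n) => [//|lni].
  by rewrite ltnNge (leq_trans lni (leq_addr _ _)) /= sy -addnBAC // ltnNge
    leq_addl addnK.
have sg x y : size x = n -> g' (scat (x ++ y) v) = g (scat y v).
  move=> sx; apply: (eq_polyfun pg) => i; rewrite scat_cat {1}/scat sx.
  by rewrite ltnNge leq_addl addnK.
rewrite ef eg; split=> [[[x sx ex] [y sy ey]]|[z sz]].
  exists (x ++ y); first by rewrite size_cat sx sy.
  by apply/sqr_subX_eq0; rewrite sf ?sg.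
rewrite -(cat_take_drop n z) => /sqr_subX_eq0.
have sx : size (take n z) = n by rewrite size_takel // sz leq_addr.
have sy : size (drop n z) = m by rewrite size_drop sz addKn.
by rewrite sf ?sg // => -[e1 e2]; split; [exists (take n z)|exists (drop n z)].
Qed.

(** The quantified value is entry 0 of the environment, hence adjacent to the unknowns: it becomes
    one more unknown at their end, and [f] stays the same. *)
Lemma dioph_ex (S : A -> (nat -> A) -> Prop) :
  dioph (fun v => S (v 0%N) (fun i => v i.+1)) -> 
  dioph (fun v => exists x, S x v).
Proof.
move=> [n [f [pf ef]]]; exists n.+1, f; split=> // v.
have sc x y : f (scat (rcons x y) v) = f (scat x (fun i => if i is i'.+1 then v
  i' else y)).
  apply: (eq_polyfun pf) => i; rewrite -cats1 scat_cat /scat /=.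
  by case: ltnP => //; case: (i - size x)%N => // j; rewrite subn1.
split=> [[y sy]|[x]].
  have [x sx ex] := (ef (fun i => if i is i'.+1 then v i' else y)).1 sy.
  by exists (rcons x y); rewrite ?size_rcons ?sx ?sc.
case/lastP: x => // x y; rewrite size_rcons sc => -[sx] ex; exists y.
by apply: (ef (fun i => if i is i'.+1 then v i' else y)).2; exists x.
Qed.

Lemma dioph_diophantine k (S : k.-tuple A -> Prop) : diophantine S ->
  forall F : 'I_k -> (nat -> A) -> A, (forall i, polyfun (F i)) ->
  dioph (fun v => S [tuple F i v | i < k]).
Proof.
move=> [n [p ep]] F pF.
(* In [diophantine] the parameters precede the unknowns, in [scat] they follow them; [G] performs
   the exchange. *)
pose G (i : 'I_(k + n)) w := match split i with
  | inl j => F j (fun l => w (l + n)%N) | inr j => w j end.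
exists n, (fun w => p.@[fun i => G i w]).
split=> [|v].
  apply: polyfun_meval => i; rewrite /G; case: (split i) => j;
    last by auto with polyfun.
  by apply: polyfun_comp; auto with polyfun.
rewrite ep; have e (x : n.-tuple A) :
    tnth [tuple of [tuple F i v | i < k] ++ x] =1 (fun i => G i (scat x v)).
  move=> i; rewrite (tnth_nth 0) /= /G.
  case: splitP => j ej; rewrite nth_cat size_map size_enum_ord ej.
    rewrite ltn_ord (nth_map j) ?size_enum_ord // nth_ord_enum.
    apply: (eq_polyfun (pF j)) => l;
      rewrite /scat size_tuple ltnNge leq_addl /=.
    by rewrite addnK.
  by rewrite ltnNge leq_addr /= addKn /scat size_tuple ltn_ord.
split=> [[x ex]|[x sx ex]].
  by exists x; rewrite ?size_tuple // -ex; apply: meval_eq => i; rewrite e.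
have sx' : size x == n by apply/eqP.
by exists (Tuple sx'); rewrite -ex; apply: meval_eq => i; rewrite e.
Qed.

Lemma diophantine_dioph (S : 1.-tuple A -> Prop) (P : A -> Prop) :
  (forall a, S [tuple a] <-> P a) -> dioph (fun v => P (v 0%N)) ->
  diophantine S.
Proof.
move=> eSP [n [f [pf ef]]].
(* Here the single parameter comes first and the unknowns follow; in [scat] it has index n. Larger
   indices read 0, in agreement with the environment [nth 0 a]. *)
pose f' w := f (fun i => if (i < n)%N then w i.+1 else
    if (i <= n)%N then w 0%N else 0).
have pf' : polyfun f'.
  apply: (@polyfun_comp _ _ (fun i w => if (i < n)%N then w i.+1 else 
    if (i <= n)%N then w 0%N else 0)) => // i.
  by case: (i < n)%N; last case: (i <= n)%N; auto with polyfun.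
have [q eq] := polyfun_mpoly (1 + n) pf'.
exists n, q => a.
have e (x : n.-tuple A) :
    f' (nth 0 (a ++ x)) = f (scat x (fun i => nth 0 a i)).
  apply: (eq_polyfun pf) => i; rewrite /scat (size_tuple x).
  case: (ltnP i n) => [lin|lni]; first by rewrite nth_cat size_tuple subn1.
  case: (ltnP n i) => [lti|le]; last first.
    have -> : i = n by apply/eqP; rewrite eqn_leq le lni.
    by rewrite subnn nth_cat size_tuple.
  by rewrite /= nth_default // size_tuple subn_gt0.
have -> : S a <-> P (a`_0).
  rewrite -eSP (_ : a = [tuple a`_0]) //; apply: val_inj.
  by case: a {e} => -[|x [|? ?]].
rewrite (ef (fun i => a`_i)); split=> [[x sx ex]|[x ex]].
  have sx' : size x == n by apply/eqP.
  by exists (Tuple sx'); move: (e (Tuple sx')) ex; rewrite -eq /= => e1 e2;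
    apply: (etrans e1 e2).
by exists x; rewrite ?size_tuple //; move: (e x) ex; rewrite -eq /= => e1 e2;
  apply: (etrans (esym e1) e2).
Qed.
End DiophantineCalculus.
(** * Pell equation and powers *)

Section Pell.
Variable A : comNzRingType.
Implicit Types (a p x y : A).

(** The pair (x_n, y_n) with x_n + y_n r = (a + r)^n, where r^2 = a^2 - 1. *)
Fixpoint pell a n : A * A :=
  if n is n'.+1 then
    let xy := pell a n' in (a * xy.1 + (a ^+ 2 - 1) * xy.2, xy.1 + a * xy.2)
  else (1, 0).

Lemma pellP a n : (pell a n).1 ^+ 2 - (a ^+ 2 - 1) * (pell a n).2 ^+ 2 = 1.
Proof.
elim: n => [|n] /=; first by rewrite expr1n expr0n mulr0 subr0.
by move: (pell a n).1 (pell a n).2 => x y e; rewrite -[RHS]e; ring.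
Qed.

(** Modulo a - 1 the recursion leaves x unchanged. This fixes the sign of x in [pospowerP]. *)
Lemma pell_mod_sub1 a n : exists q, (pell a n).1 - 1 = (a - 1) * q.
Proof.
elim: n => [|n [q eq]] /=; first by exists 0; rewrite subrr mulr0.
exists (q + (pell a n).1 + (a + 1) * (pell a n).2).
move: eq => /eqP; rewrite subr_eq => /eqP ->.
by ring.
Qed.

(** Modulo p^2 - 2ap + 1 one has (p - a)^2 = a^2 - 1, so p - a plays the role of the square root r,
    and a + r becomes p. *)
Lemma pell_mod_power a p n : exists q,
  p ^+ n - (pell a n).1 - (p - a) * (pell a n).2
    = (p ^+ 2 - a * p *+ 2 + 1) * q.
Proof.
elim: n => [|n [q eq]] /=; first by exists 0; rewrite subrr !mulr0 subr0.
exists (p * q + (pell a n).2); rewrite exprS.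
move: eq => /eqP; rewrite 2!subr_eq => /eqP ->; ring.
Qed.

(* Modulo p^2 - 2ap + 1, the conjugate solution is the inverse power. *)
Lemma pell_mod_power_conj a p n : exists q,
  ((pell a n).1 - (p - a) * (pell a n).2) * p ^+ n - 1
    = (p ^+ 2 - a * p *+ 2 + 1) * q.
Proof.
have [q eq] := pell_mod_power a p n; have := pellP a n.
move: eq => /eqP; rewrite 2!subr_eq => /eqP ->.
move: (pell a n).1 (pell a n).2 => x y e.
exists (q * (x - (p - a) * y) - y ^+ 2).
by rewrite -[X in _ - X = _]e; ring.
Qed.
End Pell.

Section PellPoly.
Variable R : idomainType.
Hypothesis char0 : [pchar R] =i pred0.
Local Notation A := {poly R}.
Implicit Types (a p f x y : A).

Lemma natr_neq0 n : n.+1%:R != 0 :> R.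
Proof. by move/pcharf0P: char0 => ->. Qed.

(** This turns equations between degrees in R[Z] into equations between naturals. *)
Lemma polynatr_inj : injective (fun n : nat => n%:R : A).
Proof.
have inj : injective (fun n : nat => n%:R : R).
  have lemnat m n : (m <= n)%N -> m%:R = n%:R :> R -> m = n.
    move=> lemn /eqP; rewrite eq_sym -subr_eq0 -natrB // => /eqP e.
    apply/eqP; rewrite eqn_leq lemn -subn_eq0.
    by case: (n - m)%N e => // k /eqP; rewrite (negPf (natr_neq0 k)).
  by move=> m n; case: (leqP m n) => [/lemnat//|/ltnW/lemnat h e]; rewrite h.
by move=> m n; rewrite -!polyC_natr => /polyC_inj/inj.
Qed.

(** The recurrence x_(n+2) = 2a x_(n+1) - x_n raises the degree by deg a at each step, since 2 is
    nonzero in R. *)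
Lemma size_pell a n : (1 < size a)%N ->
  size (pell a n).1 = (n * (size a).-1).+1.
Proof.
move=> a1.
have a2 : (a *+ 2 : A) = 2%:R *: a by rewrite scaler_nat.
have rec m : (pell a m.+2).1 = a *+ 2 * (pell a m.+1).1 - (pell a m).1.
  by rewrite /=; ring.
suff: size (pell a n).1 = (n * (size a).-1).+1 /\
      size (pell a n.+1).1 = (n.+1 * (size a).-1).+1 by case.
elim: n => [|n [ih0 ih1]].
  by rewrite /= mulr1 mulr0 addr0 size_poly1 mul1n prednK // ltnW.
split=> //; rewrite rec addrC addrC size_polyDl.
  rewrite a2 -scalerAl size_scale ?natr_neq0 // size_mul ?ih1.
  - by rewrite addnS /= [in RHS]mulSn -addSn prednK // ltnW.
  - by rewrite -size_poly_gt0 ltnW.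
  - by rewrite -size_poly_gt0 ih1.
rewrite size_polyN ih0 a2 -scalerAl size_scale ?natr_neq0 // size_mul ?ih1.
- by rewrite addnS /= mulSn; case: (size a) a1 => // -[]//= k _; lia.
- by rewrite -size_poly_gt0 ltnW.
- by rewrite -size_poly_gt0 ih1.
Qed.

(** Descent on the degree of y: with r^2 = a^2 - 1, dividing x + y r or x - y r by the unit a + r
    lowers this degree until y = 0. *)
Lemma pell_solution a x y : (1 < size a)%N ->
  x ^+ 2 - (a ^+ 2 - 1) * y ^+ 2 = 1 ->
  exists n (s t : bool), x = (-1) ^+ s * (pell a n).1 /\
                         y = (-1) ^+ t * (pell a n).2.
Proof.
move=> a1; have [m] := ubnP (size y); elim: m x y => // m ihm x y.
rewrite ltnS => leym e.
have [y0|y0] := eqVneq y 0.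
  move: e; rewrite y0 expr0n mulr0 subr0 => /eqP; rewrite sqrf_eq1.
  by case/orP=> /eqP ->; [exists 0%N, false, false|exists 0%N, true, false];
    rewrite /= !(mulr0, mulr1).
have reduce z : z = y \/ z = - y -> (size (x - a * z)%R < size y)%N ->
   exists n (s t : bool), x = (-1) ^+ s * (pell a n).1 /\
                         y = (-1) ^+ t * (pell a n).2.
  move=> zy lt.
  have ez : z ^+ 2 = y ^+ 2 by case: zy => ->; rewrite ?sqrrN.
  suff [n [s [t [ex eqz]]]] : exists n (s t : bool),
      x = (-1) ^+ s * (pell a n).1 /\ z = (-1) ^+ t * (pell a n).2.
    case: zy => zy; first by exists n, s, t; rewrite -zy.
    exists n, s, (~~ t); split=> //; rewrite -[LHS]opprK -zy eqz.
    by case: (t); rewrite ?expr0 ?expr1 ?mulN1r ?mul1r ?opprK.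
  (* This pair represents (x + z r)(a - r), where r^2 = a^2 - 1. *)
  have [||n [s [t [ex ey]]]] := ihm (a * x - (a ^+ 2 - 1) * z) (a * z - x).
  - by rewrite -opprB size_polyN (leq_trans lt).
  - by rewrite -[RHS]e -ez; ring.
  have {ihm e}ex' : x = a * ((-1) ^+ s * (pell a n).1)
                    + (a ^+ 2 - 1) * ((-1) ^+ t * (pell a n).2).
    by rewrite -ex -ey; ring.
  have ez' : z = (-1) ^+ s * (pell a n).1 + a * ((-1) ^+ t * (pell a n).2).
    by rewrite -ex -ey; ring.
  (* Equal signs lead to the next index. With opposite signs the multiplication undoes a step; at n
     = 0 the second entry vanishes, so its sign is free and the index becomes 1. *)
  have [est|est] := eqVneq s t.
    by exists n.+1, s, s; rewrite {1}ex' ez' est /=; split; ring.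
  have {est}et : t = ~~ s by case: (s) (t) est => -[].
  case: n {ex ey} ex' ez' => [|n] ex' ez'; rewrite {}et in ex' ez'.
    by exists 1%N, s, s; rewrite ex' ez' /=; split; ring.
  exists n, s, (~~ s); rewrite {}ex' {}ez' signrN /=.
  by split; ring.
(* If neither factor of (x - ay)(x + ay) = 1 - y^2 has smaller degree than y, both have degree at
   most deg y; but their difference 2ay has larger degree. *)
have size_or : (size (x - a * y)%R < size y)%N || (size (x + a * y)%R < size
  y)%N.
  rewrite -[_ || _]negbK negb_or -!leqNgt; apply/negP => /andP[le1 le2].
  have sy : (0 < size y)%N by rewrite size_poly_gt0.
  have ep : (x - a * y) * (x + a * y) = 1 - y ^+ 2.
    by rewrite -[X in _ = X - _]e; ring.
  have : ((size (x - a * y)%R + size (x + a * y)%R).-1 <= (size y + size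
    y).-1)%N.
    rewrite -size_mul -?size_poly_gt0; last 2 first.
    - exact: leq_trans sy le1.
    - exact: leq_trans sy le2.
    rewrite ep.
    apply: leq_trans (size_polyD _ _) _; rewrite geq_max size_poly1 size_polyN.
    by rewrite expr2 size_mul // leqnn andbT; case: (size y) sy => // k _; lia.
  have : size ((x + a * y) - (x - a * y)) = (size a + size y).-1.
    rewrite (_ : _ - _ = 2%:R *: (a * y)); last by rewrite scaler_nat; ring.
    by rewrite size_scale ?natr_neq0 // size_mul // -size_poly_gt0 ltnW.
  have := size_polyD (x + a * y) (- (x - a * y)).
  rewrite size_polyN leq_max => h1 h2; move: h1; rewrite h2.
  move: a1 sy le1 le2; clear.
  move: (size a) (size y) (size (x - a * y)%R) (size (x + a * y)%R) => *; lia.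
case/orP: size_or => lt.
  by apply: (reduce y) => //; left.
by apply: (reduce (- y)); [right|rewrite mulrN opprK].
Qed.

Definition divides (d x : A) := exists q, x = d * q.

Definition hasdeg (f n : A) := f != 0 /\ n = (size f).-1%:R.

Definition isnat (n : A) := exists f, hasdeg f n.

Lemma isnatP n : isnat n <-> exists m : nat, n = m%:R.
Proof.
split=> [[f [_ ->]]|[m ->]]; first by exists (size f).-1.
by exists 'X^m; split; rewrite ?size_polyXn // -size_poly_gt0 size_polyXn.
Qed.

(* The sign of y is left free: with the opposite sign f would be an inverse of
   p^k modulo p^2 - 2ap + 1, hence an inverse of p^k since a has large degree.
     *)
Definition pospower p f := exists a x y k da dp df z z',
  (((hasdeg a da /\ hasdeg p dp) /\ hasdeg f df) /\ hasdeg x (k * da)) /\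
  (((isnat k /\ isnat z) /\ isnat z') /\ dp = 1 + z') /\
  (da = (k + 2%:R) * dp + df + 1 + z /\
   x ^+ 2 - (a ^+ 2 - 1) * y ^+ 2 = 1) /\
  divides (a - 1) (x - 1) /\
  divides (p ^+ 2 - a * p *+ 2 + 1) (f - x - (p - a) * y).

Lemma divides_size d x : divides d x -> (size x < size d)%N -> x = 0.
Proof.
move=> [q ->] lt; apply/eqP; apply: contraLR lt => n0; rewrite -leqNgt.
move: (n0); rewrite mulf_eq0 negb_or => /andP[d0 q0].
by rewrite size_mul //; move: q0; rewrite -size_poly_gt0;
  case: (size q) => // k _;
  rewrite addnS leq_addr.
Qed.

(** The term 2ap dominates. The resulting degree is large enough for the congruences in [pospowerP]
    to become equalities. *)
Lemma size_pell_modulus a p : (1 < size p)%N -> (size p < size a)%N ->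
  size (p ^+ 2 - a * p *+ 2 + 1) = (size a + size p).-1.
Proof.
move=> p1 pa.
have p0 : p != 0 by rewrite -size_poly_gt0 ltnW.
have a0 : a != 0 by rewrite -size_poly_gt0 (leq_trans _ pa).
have eap : size (- (a * p *+ 2)) = (size a + size p).-1.
  by rewrite size_polyN -scaler_nat size_scale ?natr_neq0 // size_mul.
rewrite -addrA addrCA size_polyDl eap //.
rewrite size_polyDl expr2 size_mul // ?size_poly1; move: p1 pa;
 move: (size a) (size p) => *; lia.
Qed.

(** The degree of x selects the index of the Pell solution, and its residue modulo a - 1 the sign of
    x. The last congruence, whose modulus has degree above those of f and p^k, then becomes an
    equality. *)
Lemma pospowerP p f :
  pospower p f <-> (1 < size p)%N /\ exists k, f = p ^+ k.
Proof.
split; last first.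
  move=> [p1 [k ->]].
  have p0 : p != 0 by rewrite -size_poly_gt0 ltnW.
  (* ['X^D] serves as a: D is the degree required of a when f = p^k and z = 0. *)
  pose P := (size p).-1; pose D := ((k + 2) * P + k * P + 1)%N.
  have sD : size ('X^D : A) = D.+1 by rewrite size_polyXn.
  exists 'X^D, (pell 'X^D k).1, (pell 'X^D k).2, k%:R, D%:R, P%:R, (k * P)%:R,
    0, P.-1%:R.
  have sx : size (pell ('X^D : A) k).1 = (k * D).+1.
    by rewrite size_pell sD // /D addn1.
  do !split.
  - by rewrite -size_poly_gt0 sD.
  - by rewrite sD.
  - by [].
  - by rewrite expf_neq0.
  - by rewrite size_exp mulnC.
  - by rewrite -size_poly_gt0 sx.
  - by rewrite sx natrM.
  - by apply/isnatP; exists k.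
  - by apply/isnatP; exists 0%N.
  - by apply/isnatP; exists P.-1.
  - by rewrite addrC natr1 prednK // /P -subn1 subn_gt0.
  - by rewrite /D !natrD !natrM !natrD addr0.
  - exact: pellP.
  - have [q e] := pell_mod_sub1 ('X^D : A) k; by exists q.
  - have [q e] := pell_mod_power ('X^D : A) p k; by exists q.
move=> [a [x [y [k [da [dp [df [z [z' H]]]]]]]]].
case: H => [[[[[a0 ->] [p0 ->]] [f0 ->]] [x0 ex]] H].
case: H => [[[[/isnatP[k' ek] /isnatP[z1 ez]] /isnatP[z2 ez']] ep] H].
case: H => [[ea epell] [dx df']].
have {}ep : (size p).-1 = z2.+1.
  by apply: polynatr_inj; rewrite /= ep ez' -natr1 addrC.
have {}ea : (size a).-1 = ((k' + 2) * (size p).-1 + (size f).-1 + 1 + z1)%N.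
  by apply: polynatr_inj; rewrite /= ea ek ez !natrD natrM natrD.
have {}ex : (k' * (size a).-1)%N = (size x).-1.
  by apply: polynatr_inj; rewrite /= natrM -ek.
have p1 : (1 < size p)%N by case: (size p) ep => // -[].
have pa : (size p < size a)%N.
  by move: ea p1; move: (size p) (size a) => [|sp] [|sa] //=; nia.
have a1 : (1 < size a)%N := ltn_trans p1 pa.
split=> //; exists k'.
have [n [s [t [exs ey]]]] := pell_solution a1 epell.
have ekn : k' = n.
  move: ex; rewrite exs.
  have -> : size ((-1) ^+ s * (pell a n).1) = size (pell a n).1.
    by case: (s); rewrite ?expr0 ?expr1 ?mul1r ?mulN1r ?size_polyN.
  rewrite size_pell //= => /eqP; rewrite eqn_pmul2r => [/eqP->//|].
  by case: (size a) a1 => // -[].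
rewrite {k' ex ek}ekn in ea *.
(* Otherwise a - 1 would divide the nonzero constant 2. *)
have es : s = false.
  case: s exs => // exs.
  have [q eq] := pell_mod_sub1 a n; case: dx => q' eq'.
  have /divides_size : divides (a - 1) 2%:R.
    by exists (- q - q'); rewrite mulrBr mulrN -eq -eq' exs expr1; ring.
  rewrite size_polyDl ?size_polyN ?size_poly1 // -polyC_natr size_polyC
    natr_neq0.
  by move=> /(_ a1)/eqP; rewrite polyC_eq0 (negPf (natr_neq0 _)).
rewrite {s}es expr0 mul1r in exs; rewrite exs {x exs x0 epell dx} in df'.
have eM := size_pell_modulus p1 pa.
have spn : size (p ^+ n) = ((size p).-1 * n).+1 by rewrite -size_exp prednK //
  size_poly_gt0 expf_neq0.
have sf : (0 < size f)%N by rewrite size_poly_gt0.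
have [q' eq'] := df'; case: t ey eq' => ->; rewrite ?expr1 ?expr0 => eq';
  last first.
  have [q eq] := pell_mod_power a p n.
  apply/eqP; rewrite -subr_eq0; apply/eqP.
  apply: (@divides_size (p ^+ 2 - a * p *+ 2 + 1)).
    by exists (q' - q); rewrite mulrBr -eq -eq'; ring.
  apply: leq_ltn_trans (size_polyD _ _) _; rewrite size_polyN spn eM gtn_max.
  by move: ea p1 sf; clear; move: (size a) (size p) (size f) => [|sa] [|sp]
    [|sf] //=; nia.
have [q eq] := pell_mod_power_conj a p n.
have : f * p ^+ n - 1 = 0.
  apply: (@divides_size (p ^+ 2 - a * p *+ 2 + 1)).
    exists (q' * p ^+ n + q); rewrite mulrDr -eq mulrA -eq'.
    by move: (pell a n).1 (pell a n).2 (p ^+ n) => u v w; ring.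
  apply: leq_ltn_trans (size_polyD _ _) _;
    rewrite size_polyN size_poly1 eM gtn_max.
  rewrite size_mul ?expf_neq0 // spn.
  by move: ea p1 sf; clear; move: (size a) (size p) (size f) => [|sa] [|sp]
    [|sf] //=; nia.
move/eqP; rewrite subr_eq0 => /eqP e1.
(* Since p is not constant, f p^n = 1 forces n = 0, and then f = 1 = p^n. *)
have := congr1 (fun u : A => size u) e1;
  rewrite size_mul ?expf_neq0 // spn size_poly1.
case: n e1 {ea eq' q' df' eq q spn} => [|n]; first by rewrite expr0 mulr1.
by move: p1 sf; move: (size p) (size f) => [|sp] [|sf] //=; nia.
Qed.
End PellPoly.
(** * Cyclotomic integers *)

Section Cyclotomic.
Import Num.Theory Order.TTheory.
Implicit Types (S Q : {poly int}) (w z : algC).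
(** An integer of the n-th cyclotomic field is encoded by an integer polynomial; its conjugates are
    the values [ev] at the primitive n-th roots of unity. *)
Local Notation ev p x := (map_poly (intr : int -> algC) p).[x].

Lemma Cyclotomic_root n w : n.-primitive_root w -> (ev 'Phi_n w) = 0.
Proof.
by move=> pw; apply/eqP; rewrite (Cintr_Cyclotomic pw) -/(root _ _)
  root_cyclotomic.
Qed.

Lemma divp_Cyclotomic Q n : Q = Q %/ 'Phi_n * 'Phi_n + Q %% 'Phi_n.
Proof. exact: Pdiv.IdomainMonic.divp_eq (Cyclotomic_monic n) Q. Qed.

Lemma horner_modp_Cyclotomic Q n w :
  n.-primitive_root w -> ev (Q %% 'Phi_n) w = (ev Q w).
Proof.
move=> pw; rewrite {2}[Q](divp_Cyclotomic Q n) rmorphD rmorphM hornerD hornerM.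
by rewrite (Cyclotomic_root pw) mulr0 add0r.
Qed.

Lemma size_modp_Cyclotomic Q n : (size (Q %% 'Phi_n)%R <= totient n)%N.
Proof.
by rewrite -ltnS -size_Cyclotomic ltn_modpN0 // monic_neq0 // Cyclotomic_monic.
Qed.

(** Phi_n is the minimal polynomial of w over the rationals, so a remainder of smaller degree that
    vanishes at w is 0. *)
Lemma root_Cyclotomic_dvd Q n w : n.-primitive_root w -> (ev Q w) = 0 ->
  Q = Q %/ 'Phi_n * 'Phi_n.
Proof.
move=> pw Qw; rewrite {1}[Q](divp_Cyclotomic Q n).
suff -> : Q %% 'Phi_n = 0 by rewrite addr0.
set r := _ %% _; apply/eqP/negP => /negP r0.
have [p [Dp mon_p] dv_p] := minCpolyP w.
have : root (map_poly ratr (map_poly (intr : int -> rat) r)) w.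
  rewrite -map_poly_comp (eq_map_poly (fun x => ratr_int _ x)).
  by apply/eqP; rewrite horner_modp_Cyclotomic.
rewrite dv_p => /dvdp_leq; rewrite map_poly_eq0_id0 ?intr_eq0 ?lead_coef_eq0 //
  => /(_ r0).
rewrite -(size_map_poly (@ratr algC) p) -Dp (minCpoly_cyclotomic pw)
  size_cyclotomic.
rewrite ltnNge => /negP; apply.
rewrite size_map_inj_poly ?size_modp_Cyclotomic //.
exact: intr_inj.
Qed.

Lemma root_conjugate Q n w z : n.-primitive_root w -> n.-primitive_root z ->
  (ev Q w) = 0 -> (ev Q z) = 0.
Proof.
move=> pw pz /(root_Cyclotomic_dvd pw) ->.
by rewrite rmorphM hornerM (Cyclotomic_root pz) mulr0.
Qed.

Lemma primitive_roots n : (0 < n)%N -> exists rs : seq algC,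
  [/\ uniq rs, size rs = totient n & forall z, (z \in rs) = n.-primitive_root
    z].
Proof.
move=> /C_prim_root_exists[w pw].
pose rs := [seq w ^+ k | k : 'I_n in [pred k : 'I_n | coprime k n]].
have e : cyclotomic w n = \prod_(x <- rs) ('X - x%:P) by rewrite big_image.
exists rs; split=> [||z].
- rewrite map_inj_uniq ?enum_uniq // => i j /eqP.
  by rewrite (eq_prim_root_expr pw) !modn_small // => /eqP/val_inj.
- by apply/succn_inj; rewrite -(size_cyclotomic w) e size_prod_XsubC.
- by rewrite -(root_cyclotomic pw) e root_prod_XsubC.
Qed.

(* The norm of S(w) is the rational integer prod_z S(z) over the conjugates z
   of w. *)
Lemma cyclotomic_integer_small S n w : n.-primitive_root w ->
  (forall z, n.-primitive_root z -> `|(ev S z)| < 1) -> (ev S w) = 0.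
Proof.
move=> pw Slt1; have n0 := prim_order_gt0 pw.
have [rs [urs srs mrs]] := primitive_roots n0.
pose norm := \prod_(x <- rs) (ev S x).
(* [Pi] takes the norm as its value at every primitive root z, because z^k runs through all of these
   as k runs through the units modulo n. *)
pose Pi := \prod_(k < n | coprime k n) (S \Po 'X^k).
have evalPi z : n.-primitive_root z -> (ev Pi z) = norm.
  move=> pz; rewrite /Pi rmorph_prod horner_prod.
  pose rz := [seq z ^+ k | k : 'I_n in [pred k : 'I_n | coprime k n]].
  have erz : perm_eq rz rs.
    apply: uniq_perm => // [|x].
      rewrite map_inj_uniq ?enum_uniq // => i j /eqP.
      by rewrite (eq_prim_root_expr pz) !modn_small // => /eqP/val_inj.
    by rewrite mrs -(root_cyclotomic pz) -root_prod_XsubC big_image.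
  rewrite /norm -(perm_big _ erz) big_image /=; apply: eq_bigr => k _.
  by rewrite map_comp_poly map_polyXn horner_comp hornerXn.
(* [Pi] mod Phi_n minus the norm has degree less than totient n but totient n roots, so it is 0 and
   the norm is an integer coefficient. *)
have norm_int : norm \is a Num.int.
  set r := map_poly (intr : int -> algC) (Pi %% 'Phi_n).
  suff /eqP: r - norm%:P = 0.
    by rewrite subr_eq0 => /eqP/(congr1 (fun p : {poly _} => p`_0));
      rewrite coefC coef_map /= => <-.
  apply/eqP/negP => /negP r0.
  have := max_poly_roots r0 _ urs; rewrite srs ltnNge => h; suff: ~ true by [].
  have : ~~ (size (r - norm%:P)%R <= totient n)%N.
    apply: h; apply/allP => z; rewrite mrs => pz; apply/eqP.
    by rewrite hornerD hornerN hornerC horner_modp_Cyclotomic // evalPi //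
      subrr.
  move/negP=> + _; apply.
  apply: leq_trans (size_polyD _ _) _; rewrite geq_max size_polyN size_polyC.
  rewrite (leq_trans (leq_b1 _)) ?totient_gt0 // andbT.
  by rewrite size_map_inj_poly ?size_modp_Cyclotomic //; apply: intr_inj.
have [//|Sw0] := eqVneq (ev S w) 0.
have norm0 : norm != 0.
  rewrite /norm prodf_seq_neq0; apply/allP => z; rewrite mrs => pz /=.
  by apply: contra_neq Sw0; apply: (root_conjugate pz pw).
(* A nonzero rational integer has absolute value at least 1, while every factor of the norm is below
   1. *)
have := norm_intr_ge1 norm_int norm0.
rewrite real_leNgt ?normr_real ?real1 // => /negP[].
rewrite /norm (big_rem w) ?mrs //= normrM.
apply: le_lt_trans (Slt1 w pw); apply: ler_piMr => //.
rewrite normr_prod big_seq.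
suff /andP[] : 0 <= \prod_(x <- rem w rs | x \in rem w rs) `|ev S x| <= 1 by [].
apply: (big_ind (fun x => 0 <= x <= 1)) => [|x y /andP[? ?] /andP[? ?]|z].
- by rewrite ler01 lexx.
- by rewrite mulr_ge0 // mulr_ile1.
- by move/mem_rem; rewrite mrs normr_ge0 => /Slt1/ltW.
Qed.
End Cyclotomic.

(** * Integrality of digits that are cyclotomic integers *)

Section BoundedDigits.
Import Num.Theory Order.TTheory.
Local Notation ev p x := (map_poly (intr : int -> algC) p).[x].

(** Remainders of absolute value at most b / 2 leave room for digits bounded by b / 4. *)
Lemma balanced_division (c : int) (b : nat) : (0 < b)%N ->
  exists q d : int, c = q * b%:Z + d /\ (2 * `|d| <= b)%N.
Proof.
move=> b0; have [q0 [r [e [r0 rb]]]] : exists q0 r : int,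
    c = q0 * b%:Z + r /\ (0 <= r /\ r < b%:Z).
  exists (c %/ b)%Z, (c %% b)%Z; split; first exact: divz_eq.
  by rewrite modz_ge0 ?ltz_pmod //; lia.
have [le|lt] := leqP (2 * `|r|) b; first by exists q0, r.
by exists (q0 + 1), (r - b%:Z); split; lia.
Qed.

(* A base b expansion of a rational integer whose digits are cyclotomic integers
   with all conjugates bounded by b / 4 has rational integers as digits. *)
Lemma cyclotomic_digits n b h : (0 < b)%N -> (4 * h <= b)%N ->
  forall m (P : nat -> {poly int}) (c : int),
  (forall i, (i < m)%N ->
     forall w, n.-primitive_root w -> `|ev (P i) w| <= h%:R) ->
  (forall w, n.-primitive_root w ->
     \sum_(i < m) ev (P i) w * b%:R ^+ i = c%:~R) ->
  forall i, (i < m)%N -> exists d : int,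
  forall w, n.-primitive_root w -> ev (P i) w = d%:~R.
Proof.
move=> b0 hb; elim=> // m ihm P c Ph Pc.
have [q [d [ec db]]] := balanced_division c b0.
(* The digits above the lowest, minus q. At every conjugate b S(w) = d - P_0(w) has absolute value
   at most b / 2 + b / 4, so S(w) = 0: the lowest digit is d and the others expand q. *)
pose S := \sum_(i < m) P i.+1 * (b%:R ^+ i)%:P - q%:P.
have evS w : ev S w = \sum_(i < m) ev (P i.+1) w * b%:R ^+ i - q%:~R.
  rewrite rmorphB hornerD hornerN /= map_polyC hornerC rmorph_sum horner_sum.
  congr (_ - _); apply: eq_bigr => i _.
  by rewrite rmorphM hornerM /= map_polyC hornerC /= rmorphXn /= rmorph_nat.
have eS w : n.-primitive_root w -> ev (P 0%N) w - d%:~R = - (b%:R * ev S w).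
  move=> pw; rewrite evS; have := Pc w pw; rewrite big_ord_recl /= mulr1 ec.
  under eq_bigr do rewrite /bump /= add1n exprS mulrCA.
  rewrite -mulr_sumr rmorphD rmorphM /= => /(canRL (addrK _)) ->.
  by rewrite -[b%:Z%:~R]/(b%:R); ring.
have S0 w : n.-primitive_root w -> ev S w = 0.
  move=> pw; apply: (cyclotomic_integer_small pw) => z pz.
  rewrite -(ltr_pM2l (_ : 0 < b%:R :> algC)) ?ltr0n // mulr1.
  rewrite -[X in X * _]normr_nat -normrM -normrN -eS //.
  apply: le_lt_trans (ler_normB _ _) _.
  apply: (@le_lt_trans _ _ (h + `|d|)%N%:R); last by rewrite ltr_nat; lia.
  rewrite natrD lerD ?Ph // -intr_norm -[X in _ <= X]/((`|d|%N : int)%:~R)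
    ler_int; lia.
case=> [_|i]; first exists d => w pw.
  by apply/eqP; rewrite -subr_eq0 eS // S0 // mulr0 oppr0.
rewrite ltnS; apply: (ihm (fun i => P i.+1) q).
  by move=> j lj; apply: Ph.
by move=> w pw; apply/eqP; rewrite -subr_eq0 -evS S0.
Qed.
End BoundedDigits.

(** * Roots of Phi_n in extension fields, compared with complex roots of unity *)

Section CyclotomicExtension.
Import Num.Theory Order.TTheory.
Local Notation ev p x := (map_poly (intr : int -> algC) p).[x].

(** Strong induction on the degree, irreducibility being decided by excluded middle. *)
Lemma irreducible_factor (K : fieldType) (p : {poly K}) : (1 < size p)%N ->
  exists2 q, irreducible_poly q & q %| p.
Proof.
have [m] := ubnP (size p); elim: m p => // m ihm p; rewrite ltnS => lepm p1.
have [irr|red] := classic (irreducible_poly p); first by exists p.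
have [q [q1 qp nqp]] : exists q : {poly K}, [/\ size q != 1%N, q %| p & ~~ (q
  %= p)].
  apply: NNPP => nex; apply: red; split=> // q q1 qp.
  by apply: contraT => nqp; case: nex; exists q.
have p0 : p != 0 by rewrite -size_poly_gt0 ltnW.
have q0 : q != 0 by apply: contraTneq qp => ->; rewrite dvd0p.
have ltqp : (size q < size p)%N.
  by rewrite ltn_neqAle dvdp_leq // dvdp_size_eqp // nqp.
have [||r irr rq] := ihm q; first exact: leq_trans ltqp lepm.
  by rewrite ltn_neqAle eq_sym q1 size_poly_gt0.
by exists r => //; apply: dvdp_trans rq qp.
Qed.

(** Phi_n may be reducible over K, so a root of one irreducible factor is adjoined. *)
Lemma cyclotomic_extension (K : fieldType) n : (0 < n)%N ->
  exists (L : fieldType) (f : {rmorphism K -> L}) (z : L),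
  root (map_poly intr 'Phi_n) z.
Proof.
move=> n0; pose p : {poly K} := map_poly intr 'Phi_n.
have [|q irr /dvdpP[r epq]] := @irreducible_factor K p.
  rewrite /p size_map_poly_id0 ?(monicP (Cyclotomic_monic n)) ?oner_eq0 //.
  by rewrite size_Cyclotomic ltnS totient_gt0.
have [L _ [z qz _]] := irredp_FAdjoin irr.
exists L, (in_alg L), z.
rewrite (_ : map_poly _ _ = map_poly (in_alg L) p).
  by rewrite epq rmorphM rootM qz orbT.
by rewrite -map_poly_comp; apply: eq_map_poly => x /=; rewrite scaler_int.
Qed.

Section Transfer.
Variables (L : idomainType) (n : nat) (z : L).
Hypothesis char0 : [pchar L] =i pred0.
Hypothesis Phi_z : root (map_poly intr 'Phi_n) z.

Lemma intr_eq0_char0 (c : int) : (c%:~R == 0 :> L) = (c == 0).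
Proof.
have /pcharf0P eq0 := char0.
by case: c => k; rewrite ?NegzE ?mulrNz ?oppr_eq0 -pmulrn eq0.
Qed.

(** The resultant of Phi_n and Q lies in the ideal they generate, so its image in L is 0, and by
    characteristic zero it is 0 in Z. The common factor then has a complex root, which is primitive
    and conjugate to w. *)
Lemma Cyclotomic_transfer (Q : {poly int}) w : n.-primitive_root w ->
  (map_poly intr Q).[z] = 0 -> ev Q w = 0.
Proof.
move=> pw Qz; have n0 := prim_order_gt0 pw.
have [Q1|Q1] := leqP (size Q) 1.
  move: Qz; rewrite (size1_polyC Q1) !map_polyC !hornerC => /eqP.
  by rewrite intr_eq0_char0 => /eqP ->.
have Phi1 : (1 < size 'Phi_n)%N by rewrite size_Cyclotomic ltnS totient_gt0.
have res0 : resultant 'Phi_n Q = 0.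
  have [[u v] _ /= e] := resultant_in_ideal Phi1 Q1.
  apply/eqP; rewrite -intr_eq0_char0.
  have := congr1 (fun p => (map_poly (intr : int -> L) p).[z]) e.
  rewrite map_polyC hornerC rmorphD !rmorphM hornerD !hornerM /= => ->.
  by rewrite (eqP Phi_z) Qz !mulr0 addr0.
have: resultant 'Phi_n Q == 0 by rewrite res0.
rewrite resultant_eq0; set g := gcdp _ _ => g1.
have evg (p : {poly int}) x : g %| p -> ev g x = 0 -> ev p x = 0.
  move=> /Pdiv.Idomain.dvdpP[[c q] /= c0 e] gx.
  have := congr1 (fun p => ev p x) e.
  rewrite map_polyZ rmorphM hornerZ hornerM /= gx mulr0 => /eqP.
  by rewrite mulf_eq0 intr_eq0 (negPf c0) => /eqP.
have /closed_rootP[x /eqP gx] : size (map_poly (intr : int -> algC) g) != 1%N.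
  by rewrite size_map_inj_poly ?gtn_eqF //; apply: intr_inj.
have px : n.-primitive_root x.
  rewrite -(root_cyclotomic pw) -(Cintr_Cyclotomic pw); apply/eqP.
  by apply: evg gx; apply: dvdp_gcdl.
by apply: (root_conjugate px pw); apply: evg gx; apply: dvdp_gcdr.
Qed.

Lemma Cyclotomic_transfer_conv (Q : {poly int}) w : n.-primitive_root w ->
  ev Q w = 0 -> (map_poly intr Q).[z] = 0.
Proof.
move=> pw /(root_Cyclotomic_dvd pw) ->.
by rewrite rmorphM hornerM (eqP Phi_z) mulr0.
Qed.

(** By transfer in both directions, z^k = 1 exactly when w^k = 1 for a complex primitive root w. *)
Lemma Cyclotomic_root_primitive : (0 < n)%N -> n.-primitive_root z.
Proof.
move=> n0; have [w pw] := C_prim_root_exists n0.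
apply/andP; split=> //; apply/forallP => i; apply/eqP.
have evX k (F : comNzRingType) (x : F) :
   (map_poly intr ('X^k - 1 : {poly int})).[x] = x ^+ k - 1.
  by rewrite rmorphB /= map_polyXn rmorph1 hornerD hornerXn hornerN hornerC.
have e k : (z ^+ k == 1) = (w ^+ k == 1).
  rewrite -!(subr_eq0 _ 1) -(evX k L) -(evX k algC).
  by apply/eqP/eqP => [/(Cyclotomic_transfer pw)|/(Cyclotomic_transfer_conv
    pw)].
rewrite unity_rootE e -(prim_order_dvd pw); apply/idP/eqP => [/dvdn_leq h|->//].
by apply/eqP; rewrite eqn_leq ltn_ord h.
Qed.
End Transfer.
End CyclotomicExtension.

(** * Products of factors 1 - z^i X and their truncated inverses *)

Section UnityRatio.
Variable T : comNzRingType.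
Implicit Types (z : T) (s r : seq nat).

(** Indexing by exponents lets one list serve for roots of unity in different rings, and for an
    indeterminate in place of z. *)
Definition unity_prod z s : {poly T} := \prod_(i <- s) (1 - (z ^+ i) *: 'X).

(** Inverse of [unity_prod z s] modulo X^D, from truncated geometric series. *)
Definition unity_prod_inv D z s : {poly T} :=
  \prod_(i <- s) \sum_(j < D) (z ^+ i) ^+ j *: 'X^j.

Lemma unity_prod_invP D z s :
  exists q, unity_prod z s * unity_prod_inv D z s = 1 + 'X^D * q.
Proof.
rewrite /unity_prod /unity_prod_inv.
elim: s => [|i s [q ih]]; first by exists 0; rewrite !big_nil mulr0 addr0 mulr1.
set c := z ^+ i; exists (q - (c ^+ D)%:P * (1 + 'X^D * q)).
rewrite !big_cons mulrACA ih.
have -> : (1 - c *: 'X) * \sum_(j < D) c ^+ j *: 'X^j = 1 - (c ^+ D)%:P * 'X^D.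
  apply/esym; rewrite mul_polyC -exprZn -opprB subrX1 -mulNr opprB.
  by congr (_ * _); apply: eq_bigr => j _; rewrite exprZn.
by ring.
Qed.
End UnityRatio.

Lemma map_unity_prod (T S : comNzRingType) (f : {rmorphism T -> S}) z s :
  map_poly f (unity_prod z s) = unity_prod (f z) s.
Proof.
rewrite rmorph_prod; apply: eq_bigr => i _ /=.
by rewrite rmorphB rmorph1 /= map_polyZ map_polyX rmorphXn.
Qed.

Lemma map_unity_prod_inv (T S : comNzRingType) (f : {rmorphism T -> S}) D z s :
  map_poly f (unity_prod_inv D z s) = unity_prod_inv D (f z) s.
Proof.
rewrite rmorph_prod; apply: eq_bigr => i _ /=; rewrite rmorph_sum.
by apply: eq_bigr => j _ /=; rewrite map_polyZ map_polyXn !rmorphXn.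
Qed.

Section UnityBound.
Import Num.Theory Order.TTheory.

(** For |c| = 1, multiplying by 1 - cX or by a truncated geometric series in cX turns a bound 2^(i +
    M) on the i-th coefficients into 2^(i + M + 1). *)
Lemma unity_ratio_bound (C : numFieldType) (w : C) D s r i : `|w| = 1 ->
  `|(unity_prod w s * unity_prod_inv D w r)`_i| <= (2 ^ (i + size s + size
    r))%:R.
Proof.
move=> w1; have wX k : `|w ^+ k| = 1 by rewrite normrX w1 expr1n.
have inv1 (f : {poly C}) M k : (forall i, `|f`_i| <= (2 ^ (i + M))%:R) ->
    forall i, `|(f * \sum_(j < D) (w ^+ k) ^+ j *: 'X^j)`_i| <= (2 ^ (i +
      M.+1))%:R.
  move=> fM; elim: D => [|D ihD] j;
    first by rewrite big_ord0 mulr0 coef0 normr0 ler0n.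
  (* By this recursion the j-th coefficient is at most 2^(j + M) + 2^(j + M). *)
  set c := w ^+ k; have -> : \sum_(l < D.+1) c ^+ l *: 'X^l
      = 1 + c *: ('X * \sum_(l < D) c ^+ l *: 'X^l).
    rewrite big_ord_recl expr0 scale1r; congr (_ + _).
    rewrite mulr_sumr scaler_sumr; apply: eq_bigr => l _ /=.
    by rewrite -scalerAr scalerA /bump /= add1n !exprS.
  rewrite mulrDr mulr1 -scalerAr mulrCA coefD coefZ coefXM.
  apply: le_trans (ler_normD _ _) _; rewrite normrM wX mul1r.
  rewrite addnS expnS mul2n -addnn natrD lerD //.
  case: j => [|j] /=; first by rewrite normr0 ler0n.
  by apply: le_trans (ihD j) _; rewrite addnS.
have sub1 (f : {poly C}) M k : (forall i, `|f`_i| <= (2 ^ (i + M))%:R) ->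
    forall i, `|(f * (1 - (w ^+ k) *: 'X))`_i| <= (2 ^ (i + M.+1))%:R.
  move=> fM j; rewrite mulrBr mulr1 -scalerAr coefB coefZ coefMX.
  apply: le_trans (ler_normB _ _) _;
    rewrite normrM wX mul1r addnS expnS mul2n -addnn natrD.
  rewrite lerD //; case: j => [|j] /=; first by rewrite normr0 ler0n.
  by apply: le_trans (fM j) _; rewrite ler_nat leq_exp2l.
suff: forall i, `|(unity_prod w s * unity_prod_inv D w r)`_i|
   <= (2 ^ (i + (size s + size r)))%:R by move/(_ i); rewrite addnA.
rewrite {i}/unity_prod_inv; elim: r => [|k r ihr].
  rewrite big_nil mulr1 addn0 /unity_prod.
  elim: s => [|k s ihs] j.
    by rewrite big_nil coef1; case: j => [|j];
      rewrite ?normr1 ?normr0 ?ler0n ?ler1n ?expn_gt0.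
  by rewrite big_cons mulrC; apply: sub1.
by move=> j; rewrite big_cons mulrCA mulrC /= addnS; apply: inv1.
Qed.

(** Up to a scalar, a divisor of a product of linear factors X - z^i is a subproduct; the constant
    term 1 fixes the scalar. *)
Lemma unity_divisor (L : fieldType) n (z : L) m (G : {poly L}) :
  n.-primitive_root z -> G %| ('X^n - 1) ^+ m -> G`_0 = 1 ->
  exists2 s, size s = (size G).-1 & G = unity_prod z s.
Proof.
move=> pz; rewrite -(factor_Xn_sub_1 pz) -prodrXl.
pose F i := z ^+ i.
have -> : \prod_(0 <= i < n) ('X - (z ^+ i)%:P) ^+ m
    = \prod_(i <- flatten [seq nseq m i | i <- iota 0 n]) ('X - (F i)%:P).
  rewrite big_flatten big_map /index_iota subn0; apply: eq_bigr => i _.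
  by rewrite big_nseq; elim: m {G} => // m ih; rewrite exprS /= ih.
move=> /dvdp_prod_XsubC[msk]; set s := mask _ _ => eG G0.
(* The exponent (n - 1) i gives z^(-i), since z^n = 1. *)
have eF i : 'X - (F i)%:P = - (F i)%:P * (1 - z ^+ (n.-1 * i) *: 'X).
  rewrite mulrBr mulr1 -scalerAr mulNr scalerN opprK mul_polyC scalerA.
  rewrite -exprD addnC -mulSn prednK ?(prim_order_gt0 pz) //.
  by rewrite exprM (prim_expr_order pz) expr1n scale1r addrC.
exists [seq (n.-1 * i)%N | i <- s].
  by rewrite size_map (eqp_size eG) size_prod_XsubC.
have {}eG : G %= unity_prod z [seq (n.-1 * i)%N | i <- s].
  apply: eqp_trans eG _; rewrite /unity_prod big_map.
  rewrite (eq_bigr _ (fun i _ => eF i)) big_split /=.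
  have -> : \prod_(i <- s) - (F i)%:P = (\prod_(i <- s) - F i)%:P.
    by rewrite rmorph_prod; apply: eq_bigr => i _; rewrite rmorphN.
  rewrite mul_polyC eqp_scale // prodf_seq_neq0; apply/allP => i _.
  by rewrite /= oppr_eq0 expf_neq0 // (prim_root_eq0 pz) -lt0n (prim_order_gt0
    pz).
have /eqpP[[c d] /= /andP[c0 d0] e] := eG.
have := congr1 (fun p : {poly L} => p`_0) e.
rewrite /= !coefZ G0 -[(unity_prod _ _)`_0]horner_coef0 horner_prod.
rewrite big1 => [|i _]; last by rewrite !hornerE ?mulr0 ?mul0r subr0.
by rewrite !mulr1 => ecd; move: e; rewrite ecd -!mul_polyC => /mulfI; apply;
  rewrite polyC_eq0.
Qed.
End UnityBound.
(** * Integral polynomials as quotients of products of 1 - Z^d *)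

Section Soundness.
Import Num.Theory Order.TTheory.
Variable R : idomainType.
Hypothesis char0 : [pchar R] =i pred0.
Implicit Types (U G : {poly R}).

Lemma int_poly_coef U :
  (forall i, (i < size U)%N -> exists c : int, U`_i = c%:~R) ->
  exists V : {poly int}, U = map_poly intr V.
Proof.
move=> H; have [c cU] := fin_all_exists (fun i : 'I_(size U) => H i (ltn_ord
  i)).
exists (\poly_(i < size U) if insub i is Some j then c j else 0).
apply/polyP => i; rewrite coef_map coef_poly.
case: ltnP => [lti|lei]; last by rewrite nth_default.
by rewrite (insubT (fun i => i < size U)%N lti) /= -cU.
Qed.

(** The coefficients of U are carried into a field with a primitive root of unity z, written there
    as integer polynomials in z, and compared with complex cyclotomic integers, to which
    [cyclotomic_digits] applies in base 2^k. *)
Lemma unity_ratio_int_poly U G1 G2 n m D k (c : int) : (0 < n)%N ->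
  divides G1 (('X^n - 1) ^+ m) -> divides G2 (('X^n - 1) ^+ m) ->
  G1`_0 = 1 -> G2`_0 = 1 -> (size U <= D)%N -> divides 'X^D (G2 * U - G1) ->
  (size U + size G1 + size G2 <= k)%N -> U.[(2 ^ k)%:R] = c%:~R ->
  exists V : {poly int}, U = map_poly intr V.
Proof.
move=> n0 [Q1 dG1] [Q2 dG2] G10 G20 sU [Q eU] sk Uk.
have [L [f0 [z Phi_z]]] := cyclotomic_extension {fraction R} n0.
have [f f_eq0] : exists f : {rmorphism R -> L}, forall x, (f x == 0) = (x == 0).
  by exists (f0 \o @tofrac R) => x; rewrite /= fmorph_eq0 tofrac_eq0.
have f_inj : injective f.
  by move=> x y /eqP; rewrite -subr_eq0 -rmorphB f_eq0 subr_eq0 => /eqP.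
have char0L : [pchar L] =i pred0.
  apply/pcharf0P => j; rewrite -(rmorph_nat f) f_eq0.
  by move/pcharf0P: char0 => ->.
have pz := Cyclotomic_root_primitive char0L Phi_z n0.
have dvd_f G : divides G (('X^n - 1) ^+ m) -> G`_0 = 1 ->
    exists2 s, size s = (size G).-1 & map_poly f G = unity_prod z s.
  move=> [q dG] G0; have [|| s ss es] := @unity_divisor L n z m (map_poly f G)
    pz.
  - apply/dvdpP; exists (map_poly f q); rewrite mulrC -rmorphM -dG.
    by rewrite rmorphXn rmorphB rmorph1 /= map_polyXn.
  - by rewrite coef_map G0 /= rmorph1.
  by exists s => //; rewrite ss size_map_inj_poly ?rmorph0.
have [s1 ss1 e1] : exists2 s, size s = (size G1).-1 & map_poly f G1 =
  unity_prod z s.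
  by apply: dvd_f => //; exists Q1.
have [s2 ss2 e2] : exists2 s, size s = (size G2).-1 & map_poly f G2 =
  unity_prod z s.
  by apply: dvd_f => //; exists Q2.
(* The truncated quotient of G1 by G2 is formed over Z[X], with X in place of the root of unity, so
   that its coefficients specialise both at z and at complex roots. *)
pose V : {poly {poly int}} := unity_prod 'X s1 * unity_prod_inv D 'X s2.
have evV (T : comNzRingType) (x : T) i : (map_poly intr (V`_i)).[x]
    = (unity_prod x s1 * unity_prod_inv D x s2)`_i.
  pose g : {rmorphism {poly int} -> T} := horner_eval x \o map_poly intr.
  rewrite -[LHS]/(g _) -coef_map rmorphM /= map_unity_prod map_unity_prod_inv.
  by rewrite /= /horner_eval map_polyX hornerX.
(* Multiplication by the image of G2, which is coprime to X^D, reduces this to the congruence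
   between G2 U and G1. *)
have UV i : (i < D)%N -> f U`_i = (map_poly intr (V`_i)).[z].
  move=> lti; rewrite evV -coef_map; apply/eqP; rewrite -subr_eq0 -coefB;
    apply/eqP.
  set d := _ - _; suff /dvdpP[q ->] : 'X^D %| d by rewrite coefMXn lti.
  have cop : coprimep 'X^D (unity_prod z s2).
    rewrite coprimep_expl // coprimep_sym coprimepX -e2 /root horner_coef0.
    by rewrite coef_map G20 /= rmorph1 oner_eq0.
  rewrite -(Gauss_dvdpr _ cop) /d mulrBr.
  have [q eq] := unity_prod_invP D z s2.
  apply/dvdpP; exists (map_poly f Q - unity_prod z s1 * q).
  have eUf : map_poly f G2 * map_poly f U = map_poly f G1 + 'X^D * map_poly f Q.
    rewrite -rmorphM -(map_polyXn f) -rmorphM -rmorphD -eU.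
    by congr (map_poly f _); ring.
  by rewrite [X in _ - X]mulrCA eq -e2 -e1 eUf; ring.
have [w pw] := C_prim_root_exists n0.
(* [h] is b / 4. It bounds the coefficients, because their index and the lengths of s1 and s2 are
   less than the sizes of U, G1 and G2, whose sum is at most k. *)
pose b := (2 ^ k)%N; pose h := (2 ^ (k - 2))%N.
have b0 : (0 < b)%N by rewrite expn_gt0.
have sG G : G`_0 = 1 -> (0 < size G)%N.
  by move=> e; rewrite size_poly_gt0; apply: contra_eq_neq e => ->;
    rewrite coef0 eq_sym oner_eq0.
have sG1 := sG G1 G10; have sG2 := sG G2 G20.
apply: int_poly_coef => i lti.
have hb : (4 * h <= b)%N.
  rewrite /h /b (_ : 4 = 2 ^ 2)%N // -expnD leq_exp2l //; lia.
have [j ltj x px|x px|d dE] :=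
    cyclotomic_digits b0 hb (P := fun i => V`_i) (c := c) _ _ lti (n := n).
- rewrite evV; apply: le_trans (unity_ratio_bound _ _ _ _ _) _.
    apply/eqP; rewrite -(pexpr_eq1 n0) // -normrX (prim_expr_order px).
    by rewrite normr1.
  by rewrite ler_nat leq_exp2l // ss1 ss2; lia.
(* The equation U(b) = c is an integral relation in z, so it also holds at every complex primitive
   root. *)
- pose S := \sum_(j < size U) V`_j * (b%:R ^+ j)%:P - c%:P.
  have evS (T : comNzRingType) (y : T) : (map_poly intr S).[y] =
      \sum_(j < size U) (map_poly intr V`_j).[y] * b%:R ^+ j - c%:~R.
    rewrite rmorphB hornerD hornerN /= map_polyC hornerC rmorph_sum horner_sum.
    congr (_ - _); apply: eq_bigr => j _.
    by rewrite rmorphM hornerM /= map_polyC hornerC /= rmorphXn /= rmorph_nat.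
  apply/eqP; rewrite -subr_eq0 -evS; apply/eqP.
  apply: (Cyclotomic_transfer char0L Phi_z px); rewrite evS.
  apply/eqP; rewrite subr_eq0 -(rmorph_int f) -Uk horner_coef rmorph_sum.
  apply/eqP/eq_bigr => j _; rewrite -UV ?(leq_trans (ltn_ord j)) //.
  by rewrite rmorphM rmorphXn rmorph_nat.
(* The integer found over the complex numbers is carried back to z. *)
exists d; apply: f_inj; rewrite UV ?(leq_trans lti) // rmorph_int.
apply/eqP; rewrite -subr_eq0; apply/eqP.
have := @Cyclotomic_transfer_conv L n z Phi_z (V`_i - d%:P) w pw.
by rewrite !rmorphB !hornerD !hornerN /= !map_polyC !hornerC /= dE // subrr;
  apply.
Qed.
End Soundness.

(** * Integral power series as products of powers of 1 - Z^d *)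

Section Completeness.

Section Divides.
Variable R : idomainType.
Implicit Types d x y : {poly R}.

Lemma divides_refl x : divides x x.
Proof. by exists 1; rewrite mulr1. Qed.

Lemma divides_trans d x y : divides d x -> divides x y -> divides d y.
Proof. by move=> [q ->] [r ->]; exists (q * r); rewrite mulrA. Qed.

Lemma divides_mul d e x y : divides d x -> divides e y -> divides (d * e) (x *
  y).
Proof. by move=> [q ->] [r ->]; exists (q * r); rewrite mulrACA. Qed.

Lemma divides_exp d x n : divides d x -> divides (d ^+ n) (x ^+ n).
Proof. by move=> [q ->]; exists (q ^+ n); rewrite exprMn. Qed.

Lemma divides_exp2l x m n : (m <= n)%N -> divides (x ^+ m) (x ^+ n).
Proof. by move=> /subnKC <-; exists (x ^+ (n - m)); rewrite exprD. Qed.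

Lemma divides_Xn_sub1 a b :
  divides ('X^a - 1 : {poly R}) ('X^(a * b) - 1).
Proof. by exists (\sum_(i < b) ('X^a) ^+ i); rewrite exprM; exact: subrX1. Qed.
End Divides.

(** The two lowest terms of the binomial expansion suffice to correct one coefficient. *)
Lemma one_subXn_exp (d a : nat) : exists r : {poly int},
  (1 - 'X^(d.+1)) ^+ a = 1 - a%:R * 'X^(d.+1) + 'X^(d.+2) * r.
Proof.
elim: a => [|a [r ih]]; first by exists 0; rewrite mul0r subr0 mulr0 addr0.
exists (r * (1 - 'X^(d.+1)) + a%:R * 'X^d).
rewrite exprSr ih -natr1 !(exprS 'X); ring.
Qed.

(* Every power series 1 + Z Z[[Z]] is a product of integral powers of the
   series 1 - Z^d. *)
Lemma unity_ratio_exists (u : {poly int}) d : u`_0 = 1 ->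
  exists n m (g1 g2 : {poly int}),
  [/\ (0 < n)%N,
      divides g1 (('X^n - 1) ^+ m) /\ divides g2 (('X^n - 1) ^+ m),
      g1`_0 = 1 /\ g2`_0 = 1 & divides 'X^d (g2 * u - g1)].
Proof.
move=> u0; elim: d => [|d [n [m [g1 [g2 [n0 [dg1 dg2] [g10 g20] [q eq]]]]]]].
  exists 1%N, 0%N, 1, 1; split; rewrite ?coef1 //.
    by split; apply: divides_refl.
  by exists (1 * u - 1); rewrite expr0 [RHS]mul1r.
have coef0M (f g : {poly int}) : (f * g)`_0 = f`_0 * g`_0.
  by rewrite -!horner_coef0 hornerM.
have coefX (f : {poly int}) : f`_0 = 0 -> divides 'X f.
  move=> f0; have /factor_theorem[p ->] : root f 0 by rewrite /root
    horner_coef0 f0.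
  by exists p; rewrite subr0 mulrC.
(* Modulo X it is enough that the constant terms agree; the later steps correct by 1 - X^d with d
   positive. *)
case: d eq => [|d] eq.
  exists n, m, g1, g2; split=> //; apply: coefX.
  by rewrite coefB coef0M g10 g20 u0 mulr1 subrr.
(* The error coefficient is split into naturals: multiplying g1 by h^a1 and g2 by h^a2 changes it by
   a1 - a2, which cancels it. *)
have [a1 [a2 ea]] : exists a1 a2 : nat, q`_0 = a2%:R - a1%:R.
  case: (q`_0) => k; first by exists 0%N, k; rewrite subr0 natz.
  by exists k.+1, 0%N; rewrite sub0r NegzE natz.
pose h : {poly int} := 1 - 'X^(d.+1).
have h0 a : (h ^+ a)`_0 = 1.
  by rewrite -horner_coef0 !hornerE expr0n subr0 expr1n.
(* X^(n(d+1)) - 1 is a multiple of both X^n - 1 and X^(d+1) - 1. *)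
have dh a : divides (h ^+ a) (('X^(n * d.+1) - 1) ^+ a).
  apply: divides_exp; rewrite mulnC.
  by apply: divides_trans (divides_Xn_sub1 _ _ _); exists (-1); rewrite /h;
    ring.
have dg g a : (a <= a1 + a2)%N -> divides g (('X^n - 1) ^+ m) ->
    divides (g * h ^+ a) (('X^(n * d.+1) - 1) ^+ (m + (a1 + a2))).
  move=> le dg; rewrite exprD; apply: divides_mul.
    by apply: divides_trans dg _; apply: divides_exp; apply: divides_Xn_sub1.
  exact: divides_trans (dh a) (divides_exp2l _ le).
exists (n * d.+1)%N, (m + (a1 + a2))%N, (g1 * h ^+ a1), (g2 * h ^+ a2).
split.
- by rewrite muln_gt0 n0.
- by split; apply: dg; rewrite ?leq_addr ?leq_addl.
- by rewrite !coef0M !h0 g10 g20.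
have [r1 e1] := one_subXn_exp d a1; have [r2 e2] := one_subXn_exp d a2.
have [t et] : divides 'X (q - (a2%:R - a1%:R) * g1).
  apply: coefX; rewrite coefB coef0M g10 mulr1 ea.
  by rewrite -!polyC_natr -rmorphB coefC subrr.
move: eq => /(canRL (subrK _)) eq.
rewrite mulrAC eq e1 e2 !(exprSr 'X).
exists (t + q * ('X * r2 - a2%:R) * 'X^d + g1 * (r2 - r1)).
move: et => /(canRL (subrK _)) ->.
by ring.
Qed.
End Completeness.

(** * Existential description of Z[Z] inside R[Z] *)

Section Witness.
Import Num.Theory Order.TTheory.
Variable R : idomainType.
Hypothesis char0 : [pchar R] =i pred0.
Local Notation A := {poly R}.

(* W = Z^n, E = (W - 1)^m, T = Z^D, T' = Z^k and b = 2^k = T'(2). *)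
Definition int_poly_witness (F : A) := exists W E G1 G2 T T' b n1 n2 dU d1 d2 z
  z',
  (pospower 'X W /\ pospower (W - 1) E) /\
  ((divides G1 E /\ divides G2 E) /\
   (divides 'X (G1 - 1) /\ divides 'X (G2 - 1))) /\
  ((pospower 'X T /\ divides T (G2 * (1 + 'X * F) - G1)) /\
   (hasdeg (1 + 'X * F) dU /\ hasdeg T (dU + 1 + z) /\ isnat z)) /\
  ((pospower 'X T' /\ (hasdeg G1 d1 /\ hasdeg G2 d2)) /\
   (hasdeg T' (dU + d1 + d2 + 3%:R + z') /\ isnat z')) /\
  ((isnat b /\ divides ('X - 2%:R) (T' - b)) /\
   (isnat n1 /\ isnat n2 /\ divides ('X - b) (1 + 'X * F - (n1 - n2)))).

Lemma divides_XsubC (p : A) c : divides ('X - c%:P) p <-> p.[c] = 0.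
Proof.
split=> [[q ->]|p0]; first by rewrite !hornerE subrr mul0r.
have /factor_theorem[q ->] : root p c by apply/eqP.
by exists q; rewrite mulrC.
Qed.

Lemma divides_Xsubn (p : A) (k : nat) : divides ('X - k%:R) p <-> p.[k%:R] = 0.
Proof. by rewrite -polyC_natr divides_XsubC. Qed.

Lemma divides_X_sub1 (p : A) : divides 'X (p - 1) <-> p`_0 = 1.
Proof.
rewrite -['X]subr0 divides_XsubC hornerD hornerN hornerC horner_coef0.
by split=> [/eqP|->]; rewrite ?subrr // subr_eq0 => /eqP.
Qed.

Lemma pospower_X (p : A) : pospower 'X p <-> exists k, p = 'X^k.
Proof.
rewrite pospowerP // size_polyX; split=> [[_]|] [k ->]; last split=> //;
  by exists k.
Qed.

(** Forwards, the data come from [unity_ratio_exists] for 1 + Z F. Backwards, [unity_ratio_int_poly]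
    makes 1 + Z F integral, and with it F. *)
Lemma int_poly_witnessP F : @int_polys R [tuple F] <-> int_poly_witness F.
Proof.
split=> [[q /(congr1 (fun t : 1.-tuple A => tnth t 0)) /= eF]|].
  rewrite /tnth /= in eF.
  pose u : {poly int} := 1 + 'X * q; pose U : A := 1 + 'X * F.
  pose f := map_poly (intr : int -> R).
  have eU : f u = U by rewrite /f rmorphD rmorphM rmorph1 /= map_polyX -eF.
  have u0 : u`_0 = 1 by rewrite coefD coef1 coefXM addr0.
  have U0 : U`_0 = 1 by rewrite coefD coef1 coefXM addr0.
  have nz (p : A) : p`_0 = 1 -> size p = (size p).-1.+1.
    move=> e; rewrite prednK // size_poly_gt0; apply: contra_eq_neq e => ->.
    by rewrite coef0 eq_sym oner_eq0.
  have [n [m [g1 [g2 [n0 [dg1 dg2] [g10 g20] dU]]]]] := unity_ratio_exists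
    (size U) u0.
  have fdiv p p' : divides p p' -> divides (f p) (f p').
    by move=> [r ->]; exists (f r); rewrite /f rmorphM.
  have fE : f (('X^n - 1) ^+ m) = ('X^n - 1) ^+ m.
    by rewrite /f rmorphXn rmorphB rmorph1 /= map_polyXn.
  have f0 (p : {poly int}) : p`_0 = 1 -> (f p)`_0 = 1 by move=> e;
    rewrite coef_map e /= rmorph1.
  (* Three degrees plus 3 make the sum of the three sizes, the lower bound on k in the digit
     argument. *)
  pose k := ((size U).-1 + (size (f g1)).-1 + (size (f g2)).-1 + 3)%N.
  (* A difference of naturals, because [isnat] expresses only these. *)
  have [n1 [n2 en]] : exists n1 n2 : nat, u.[(2 ^ k)%:R] = n1%:R - n2%:R.
    case: (u.[_]) => j; first by exists j, 0%N; rewrite subr0 natz.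
    by exists 0%N, j.+1; rewrite sub0r NegzE natz.
  exists 'X^n, (('X^n - 1) ^+ m), (f g1), (f g2), 'X^(size U), 'X^k, (2 ^ k)%:R,
    n1%:R, n2%:R, (size U).-1%:R, (size (f g1)).-1%:R, (size (f g2)).-1%:R,
    0, 0.
  have W1 : (1 < size ('X^n - 1 : A)%R)%N by rewrite size_XnsubC.
  do !split.
  - by apply/pospower_X; exists n.
  - by apply/pospowerP => //; split=> //; exists m.
  - by rewrite -fE; apply: fdiv.
  - by rewrite -fE; apply: fdiv.
  - by apply/divides_X_sub1/f0.
  - by apply/divides_X_sub1/f0.
  - by apply/pospower_X; exists (size U).
  - move/fdiv: dU; rewrite -/U -eU.
    by rewrite /f rmorphB rmorphM /= map_polyXn.
  - by rewrite -/U -size_poly_gt0 nz.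
  - by rewrite -size_poly_gt0 size_polyXn.
  - by rewrite size_polyXn addr0 natr1 -nz.
  - by apply/isnatP; exists 0%N.
  - by apply/pospower_X; exists k.
  - by rewrite -size_poly_gt0 nz ?f0.
  - by rewrite -size_poly_gt0 nz ?f0.
  - by rewrite -size_poly_gt0 size_polyXn.
  - by rewrite size_polyXn addr0 /k !natrD.
  - by apply/isnatP; exists 0%N.
  - by apply/isnatP; exists (2 ^ k)%N.
  - apply/divides_Xsubn; rewrite hornerD hornerN hornerXn -polyC_natr hornerC.
    by rewrite natrX subrr.
  - by apply/isnatP; exists n1.
  - by apply/isnatP; exists n2.
  apply/divides_Xsubn; rewrite -/U -eU -!polyC_natr -polyCB hornerD hornerN
    hornerC.
  rewrite -(rmorph_nat (intr : {rmorphism int -> R})) horner_map en.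
  by rewrite rmorphB !rmorph_nat subrr.
move=> [W [E [G1 [G2 [T [T' [b [n1 [n2 [dU [d1 [d2 [z [z' H]]]]]]]]]]]]]].
move: H; set U := 1 + 'X * F.
case=> [[/pospower_X [n ->] /(pospowerP char0)[W1 [m ->]]]].
case=> [[[dG1 dG2] [/divides_X_sub1 G10 /divides_X_sub1 G20]]].
case=> [[[/pospower_X[D ->] dD] [[U0 ->] [[_ eT] /isnatP[z1 ez]]]]].
case=> [[[/pospower_X[k ->] [[G1n ->] [G2n ->]]] [[_ eT'] /isnatP[z2 ez']]]].
case=> [[/isnatP[b1 ->] /divides_Xsubn eb] [/isnatP[c1 ->] [/isnatP[c2 ->]
  /divides_Xsubn eU]]].
have eD : D = ((size U).-1 + 1 + z1)%N.
  by apply: (polynatr_inj char0); move: eT;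
    rewrite size_polyXn /= ez !natrD => ->.
have ek : k = ((size U).-1 + (size G1).-1 + (size G2).-1 + 3 + z2)%N.
  by apply: (polynatr_inj char0); move: eT';
    rewrite size_polyXn /= ez' !natrD => ->.
(* For n = 0 the base W - 1 would be 0, but [pospower] forces a nonconstant base. *)
have n0 : (0 < n)%N by case: n W1 {dG1 dG2} => //; rewrite subrr size_poly0.
have eb1 : (b1%:R : R) = (2 ^ k)%:R.
  move: eb; rewrite -[X in 'X^k - X]polyC_natr hornerD hornerN hornerC hornerXn.
  by rewrite natrX => /eqP; rewrite subr_eq0 => /eqP.
have [|||V eV] := @unity_ratio_int_poly R char0 U G1 G2 n m D k (c1%:Z - c2%:Z)
  n0 dG1 dG2 G10 G20 _ dD.
- by rewrite eD; lia.
- by rewrite ek; lia.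
- move: eU; rewrite -eb1 -!polyC_natr -polyCB hornerD hornerN hornerC => /eqP.
  by rewrite subr_eq0 => /eqP ->; rewrite rmorphB.
(* F is recovered from V = 1 + Z F by dropping the constant term and shifting. *)
exists (\poly_(i < (size V).-1) V`_i.+1).
have -> // : F = map_poly intr (\poly_(i < (size V).-1) V`_i.+1).
apply/polyP => i; rewrite coef_map coef_poly /=.
have := congr1 (fun p : A => p`_i.+1) eV.
rewrite coefD coef1 coefXM add0r /= coef_map /= => ->.
case: ltnP => // le; rewrite nth_default //.
by move: le; case: (size V).
Qed.
End Witness.

(** * Diophantine relations obtained from the degree function *)

Section DiophantineRelations.
Variable R : idomainType.
Hypothesis deg_dioph : diophantine (@degree_graph R).
Local Notation A := {poly R}.
Implicit Types f g : (nat -> A) -> A.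

Lemma dioph_subst (S : (nat -> A) -> Prop) (h : nat -> (nat -> A) -> A) :
  dioph S -> (forall i, polyfun (h i)) -> dioph (fun v => S (fun i => h i v)).
Proof.
move=> [n [f [pf ef]]] ph.
(* The n unknowns in front stay in place; the parameters behind them are replaced by functions of
   the new parameters. *)
pose h' i (w : nat -> A) := if (i < n)%N then w i
  else h (i - n)%N (fun j => w (j + n)%N).
exists n, (fun w => f (fun i => h' i w)); split=> [|v].
  apply: polyfun_comp => // i; rewrite /h'; case: (i < n)%N; auto with polyfun.
  by apply: polyfun_comp; auto with polyfun.
have e x : size x = n -> f (fun i => h' i (scat x v)) = f (scat x (fun i => h i
  v)).
  move=> sx; apply: (eq_polyfun pf) => i; rewrite /h' [RHS]/scat sx.
  case: ltnP => [lti|lei]; first by rewrite /scat sx lti.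
  apply: (eq_polyfun (ph _)) => j.
  by rewrite /scat sx ltnNge leq_addl /= addnK.
by rewrite ef; split=> -[x sx ex]; exists x; rewrite ?e // -e.
Qed.

Lemma dioph_subst1 (P : A -> Prop) f : dioph (fun v => P (v 0%N)) ->
  polyfun f -> dioph (fun v => P (f v)).
Proof. by move=> dP pf; apply: (dioph_subst (h := fun=> f) dP). Qed.

Lemma dioph_subst2 (P : A -> A -> Prop) f g : dioph (fun v => P (v 0%N) (v
  1%N)) ->
  polyfun f -> polyfun g -> dioph (fun v => P (f v) (g v)).
Proof.
move=> dP pf pg.
by apply: (dioph_subst (h := fun i => if i == 0%N then f else g) dP) => -[].
Qed.

Lemma dioph_hasdeg f g : polyfun f -> polyfun g ->
  dioph (fun v => hasdeg (f v) (g v)).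
Proof.
apply: dioph_subst2.
apply: dioph_ext (dioph_diophantine deg_dioph (F := fun i v => v (nat_of_ord
  i)) _) _.
  by move=> i; auto with polyfun.
move=> v; split=> [[F F0 e]|[v00 e]].
  have e0 := congr1 (fun t => tnth t 0) e;
    have e1 := congr1 (fun t => tnth t 1) e.
  by move: e0 e1; rewrite !tnth_mktuple /= => -> ->.
exists (v 0%N) => //; apply: eq_from_tnth => i; rewrite tnth_mktuple.
by case: i => -[|[]].
Qed.

Lemma dioph_isnat f : polyfun f -> dioph (fun v => isnat (f v)).
Proof.
apply: dioph_subst1; apply: dioph_ex; apply: dioph_hasdeg; auto with polyfun.
Qed.

Lemma dioph_divides f g : polyfun f -> polyfun g ->
  dioph (fun v => divides (f v) (g v)).
Proof.
apply: dioph_subst2; apply: dioph_ex; apply: dioph_eq; auto with polyfun.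
Qed.

Lemma dioph_pospower f g : polyfun f -> polyfun g ->
  dioph (fun v => pospower (f v) (g v)).
Proof.
apply: dioph_subst2; rewrite /pospower.
do 9![apply: dioph_ex => /=].
repeat first [apply: dioph_hasdeg | apply: dioph_isnat | apply: dioph_divides
  | apply: dioph_eq | apply: dioph_and]; auto 20 with polyfun.
Qed.
End DiophantineRelations.

Theorem theorem12 (R : idomainType)
    (noethR : noetherian R)
    (char0 : [pchar R] =i pred0)
    (deg_dioph : diophantine (@degree_graph R)) :
  diophantine (@int_polys R).
Proof.
apply: (diophantine_dioph (int_poly_witnessP char0)).
(* Once the fourteen witnesses are entries of the environment, a conjunction of degree, naturality,
   divisibility and power relations between polynomial functions remains. *)
rewrite /int_poly_witness; do 14![apply: dioph_ex => /=].
repeat first [apply: (dioph_hasdeg deg_dioph) | apply: (dioph_isnat deg_dioph)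
  | apply: dioph_divides | apply: (dioph_pospower deg_dioph) 
  | apply: dioph_eq | apply: dioph_and]; auto 20 with polyfun.
Qed.
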